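(* For $q\in(0,1/2]$ and $y\in[0,-\log q)$, let $$g_q(y):=\log^2(2)+\big(\log(1-q)+y\big)\big(-\log(q)-y\big),$$ $$\hat f_q(y):=\frac{2\log^2(2)+\big(\log(1-q)+y\big)\log\frac{1-q}{q}+(\log 4)\sqrt{g_q(y)}}{\log^2\big((1-q)/q\big)+\log^2(2)},\qquad \tilde f_q(y):=\frac{y+\log(2)}{\log(1/q)}.$$ Then $$\lim_{q\to0^+}\ \lim_{y\to0^+}\ \frac{\hat f_q(y)}{\tilde f_q(y)}=0.$$
   Context: Logarithms are natural, and $\log^2(x)=(\log x)^2$. The functions $\hat f_q(y)$ and $\tilde f_q(y)$ are two upper bounds on the probability $P(E)$ of an event $E$ with $q=Q(E)$ and $y=D(P\|Q)$ (KL divergence), for probability distributions $P,Q$. *)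

(* Defs.v *)
From HB Require Import structures.
From mathcomp Require Import all_boot all_order all_algebra.
From mathcomp Require Import all_classical all_reals all_analysis.

Set Implicit Arguments.
Unset Strict Implicit.
Unset Printing Implicit Defensive.

Import Order.TTheory GRing.Theory Num.Theory.
Local Open Scope ring_scope.

(* The functions below are meant for 0 < q <= 1/2 and 0 <= y < - ln q. There
   gfun is nonnegative and every logarithm has a positive argument, so the
   default values of Num.sqrt and ln on nonpositive inputs play no role. *)

Definition gfun (R : realType) (q y : R) : R :=
  ln 2 ^+ 2 + (ln (1 - q) + y) * (- ln q - y).

Definition fhat (R : realType) (q y : R) : R :=
  (2 * ln 2 ^+ 2 + (ln (1 - q) + y) * ln ((1 - q) / q)
     + ln 4 * Num.sqrt (gfun q y))
  / (ln ((1 - q) / q) ^+ 2 + ln 2 ^+ 2).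

Definition ftilde (R : realType) (q y : R) : R :=
  (y + ln 2) / ln (1 / q).

(* Main.v *)
Require Import Defs.
From HB Require Import structures.
From mathcomp Require Import all_boot all_order all_algebra.
From mathcomp Require Import all_classical all_reals all_analysis.
From mathcomp Require Import ring lra.

Set Implicit Arguments.
Unset Strict Implicit.
Unset Printing Implicit Defensive.

Import Order.TTheory GRing.Theory Num.Theory.
Import numFieldNormedType.Exports.
Local Open Scope classical_set_scope.
Local Open Scope ring_scope.

(* At [y = 0] write a = ln 2, m = ln (1 - q) and L = - ln q. Since
   -2q <= m <= 0 and q L <= 1, the product m L stays in [-2, 0], so the
   numerator of [fhat q 0] is bounded while its denominator
   (m + L)^2 + a^2 grows like L^2. Dividing by [ftilde q 0 = a / L] leaves a
   ratio of order 1 / L, which tends to 0. *)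

(** The ratio is continuous at [y = 0]: the denominator of [fhat] is constant in [y], [Num.sqrt] is
    continuous everywhere, and [ftilde q 0] is positive since [q < 1]. *)
Lemma cvg_fhat_ftilde (R : realType) (q : R) : 0 < q -> q <= 1 / 2 ->
  fhat q y / ftilde q y @[y --> (0 : R)^'+] --> fhat q 0 / ftilde q 0.
Proof.
move=> q0 q12.
have Lq : 0 < ln (1 / q) by apply: ln_gt0; rewrite ltr_pdivlMr //; lra.
have l2 : 0 < ln 2 :> R by apply: ln_gt0; lra.
apply: cvg_at_right_filter.
have g0 : gfun q y @[y --> (0 : R)] --> gfun q 0.
  rewrite /gfun; apply: cvgD; first exact: cvg_cst.
  apply: cvgM; first by apply: cvgD; [exact: cvg_cst|exact: cvg_id].
  by apply: cvgB; [exact: cvg_cst|exact: cvg_id].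
apply: cvgM.
  rewrite /fhat; apply: cvgMr_tmp; apply: cvgD.
    apply: cvgD; first exact: cvg_cst.
    by apply: cvgMr_tmp; apply: cvgD; [exact: cvg_cst|exact: cvg_id].
  apply: cvgMl_tmp; apply: continuous_cvg => //; exact: sqrt_continuous.
apply: cvgV; first by rewrite /ftilde add0r gt_eqF// divr_gt0.
by apply: cvgMr_tmp; apply: cvgD; [exact: cvg_id|exact: cvg_cst].
Qed.

(** This is [ln (1 + t) <= t] at [t = x^-1 - 1]. *)
Lemma oppr_ln_le (R : realType) (x : R) : 0 < x -> - ln x <= x^-1 - 1.
Proof.
move=> x0; rewrite -lnV ?posrE//.
have := @le_ln1Dx R (x^-1 - 1); rewrite (addrC 1) subrK; apply.
by rewrite ltrBrDr addNr invr_gt0.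
Qed.

Lemma ln1B_ge (R : realType) (q : R) : 0 < q -> q <= 1 / 2 ->
  - (2 * q) <= ln (1 - q).
Proof.
move=> q0 q12; have p0 : 0 < 1 - q by lra.
have := oppr_ln_le p0.
have : (1 - q)^-1 - 1 <= 2 * q.
  by rewrite lerBlDr -div1r ler_pdivrMr//; nra.
lra.
Qed.

Lemma fhat0_ftilde0_le (R : realType) (q : R) :
    0 < q -> q <= 1 / 2 -> 2 <= - ln q ->
  `|fhat q 0 / ftilde q 0| <=
    4 * ((3 * ln 2 ^+ 2 + 2 + ln 4 * ln 2) / ln 2) / - ln q.
Proof.
move=> q0 q12 L2.
have a0 : 0 < ln 2 :> R by apply: ln_gt0; lra.
have b0 : 0 < ln 4 :> R by apply: ln_gt0; lra.
have m0 : ln (1 - q) <= 0 by apply: ln_le0; lra.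
have mq := ln1B_ge q0 q12.
have qL : q * - ln q <= 1.
  rewrite -ler_pdivlMl// mulr1; apply: le_trans (oppr_ln_le q0) _; lra.
rewrite /fhat /ftilde /gfun div1r lnV ?posrE//.
rewrite lnM ?posrE ?invr_gt0//; last lra.
rewrite lnV ?posrE// !addr0 add0r subr0.
move: (ln 2) (ln 4) (ln (1 - q)) (- ln q) L2 a0 b0 m0 mq qL => a b m L.
move=> L2 a0 b0 m0 mq qL.
have mL : - 2 <= m * L by nra.
have s0 := sqrtr_ge0 (a ^+ 2 + m * L).
have sa : Num.sqrt (a ^+ 2 + m * L) <= a.
  rewrite -[leRHS]gtr0_norm// -sqrtr_sqr ler_wsqrtr// gerDl; nra.
set s := Num.sqrt _ in s0 sa *.
(* Here [m >= - (2 * q) >= - 1 >= - L / 2], so [m + L >= L / 2]. *)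
have D0 : L ^+ 2 / 4 <= (m + L) ^+ 2 + a ^+ 2 by nra.
set N := 2 * a ^+ 2 + _ + _; set D := _ + a ^+ 2 in D0 *.
set C := 3 * _ + _ + _.
(* The middle term [m * (m + L)] lies in [-2, 0], because [m <= 0 <= m + L] and [m * L >= - 2]; the
   last one lies between 0 and [b * a]. *)
have NC : `|N| <= C by rewrite ler_norml /N /C; apply/andP; split; nra.
have Dp : 0 < D by apply: lt_le_trans D0; nra.
have L0 : 0 < L by lra.
have -> : N / D / (a / L) = N * (L / (D * a)).
  by field; rewrite !gt_eqF.
rewrite normrM [X in _ * X]gtr0_norm; last by rewrite divr_gt0// mulr_gt0.
have -> : 4 * (C / a) / L = C * (4 / (L * a)) by field; rewrite !gt_eqF.
apply: ler_pM => //; first by rewrite divr_ge0 ?mulr_ge0// ltW.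
(* With denominators cleared, what remains is [D0] multiplied by [4 * a]. *)
rewrite ler_pdivrMr ?mulr_gt0// mulrAC ler_pdivlMr ?mulr_gt0//.
rewrite -subr_ge0.
have -> : 4 * (D * a) - L * (L * a) = 4 * a * (D - L ^+ 2 / 4) by field.
by rewrite mulr_ge0 ?subr_ge0// mulr_ge0// ltW.
Qed.

(** Since [lim] takes a default value on a divergent filter, the first conjunct certifies that the
    inner limit in the second is genuine. *)
Theorem mainTheorem3 (R : realType) :
  (forall q : R, 0 < q -> q <= 1 / 2 ->
     cvg (fhat q y / ftilde q y @[y --> (0 : R)^'+])) /\
  (lim (fhat q y / ftilde q y @[y --> (0 : R)^'+]) @[q --> (0 : R)^'+]
     --> (0 : R)).
Proof.
split=> [q q0 q12|].
  by apply/cvg_ex; eexists; exact: cvg_fhat_ftilde.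
apply/cvgr0Pnorm_le => e e0.
pose K : R := 4 * ((3 * ln 2 ^+ 2 + 2 + ln 4 * ln 2) / ln 2).
near=> q.
have q0 : 0 < q by near: q; exact: nbhs_right_gt.
have q12 : q <= 1 / 2 by near: q; apply: nbhs_right_le; lra.
(* Any lower bound on [- ln q] thus holds near 0; the bound [K / e] is the one that makes
   [K / - ln q] at most [e]. *)
have Lge M : q <= expR (- M) -> M <= - ln q.
  by move=> qM; rewrite lerNr -[leRHS]expRK ler_ln ?posrE ?expR_gt0.
have L2 : 2 <= - ln q.
  by apply: Lge; near: q; apply: nbhs_right_le; exact: expR_gt0.
have LK : K / e <= - ln q.
  by apply: Lge; near: q; apply: nbhs_right_le; exact: expR_gt0.
rewrite (cvg_lim _ (cvg_fhat_ftilde q0 q12))//.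
apply: le_trans (fhat0_ftilde0_le q0 q12 L2) _.
rewrite ler_pdivrMr; last lra.
by rewrite -ler_pdivrMl 1?mulrC.
Unshelve. all: by end_near.
Qed.
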